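(* For every derivation in $\mathsf{KS1}$ from $\mathsf t$ to a formula $A$, there is a formula $A'$ with no occurrence of $\mathsf f$, a derivation in $\mathsf{MLS1^X}$ from $\mathsf t$ to $A'$, and a derivation from $A'$ to $A$ using only the rules $\{\mathsf w,\mathsf c,\equiv\}$.
   Context: Fix pairwise disjoint countably infinite sets of variables, function symbols and predicate symbols, each symbol with a finite arity; each predicate symbol $p$ has a dual $\bar p$ with $\bar{\bar p}=p\neq\bar p$. Terms: $t::=x\mid f(t_1,\dots,t_n)$. Atoms: $a::=\mathsf t\mid\mathsf f\mid p(t_1,\dots,t_n)\mid\bar p(t_1,\dots,t_n)$ ($\mathsf t$ true, $\mathsf f$ false). Formulas: $A::=a\mid A\wedge A\mid A\vee A\mid\exists x.A\mid\forall x.A$. Negation: $\bar{\mathsf t}=\mathsf f$, $\bar{\mathsf f}=\mathsf t$, $\overline{p(\vec t)}=\bar p(\vec t)$, $\overline{\bar p(\vec t)}=p(\vec t)$. The equivalence $\equiv$ is the smallest congruence with: $\wedge,\vee$ commutative and associative; $\forall x.\forall y.A\equiv\forall y.\forall x.A$; $\exists x.\exists y.A\equiv\exists y.\exists x.A$; $\forall x.(A\vee B)\equiv(\forall x.A)\vee B$ and $\exists x.(A\wedge B)\equiv(\exists x.A)\wedge B$ when $x$ is not free in $B$. A context $S\{\ \}$ is a formula with exactly one hole in place of an atom. A derivation in a set of rules from premise $B$ to conclusion $A$ is a finite sequence of formulas from $B$ to $A$, each obtained from the previous by one rule instance. Rules (premise $\Rightarrow$ conclusion, in any context $S$): $\forall$: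 $S\{\mathsf t\}\Rightarrow S\{\forall x.\mathsf t\}$; $\mathsf{ai}$: $S\{\mathsf t\}\Rightarrow S\{a\vee\bar a\}$ ($a$ an atom); $\mathsf t$-rule: $S\{A\}\Rightarrow S\{A\wedge\mathsf t\}$; $\mathsf s$: $S\{A\wedge(B\vee C)\}\Rightarrow S\{(A\wedge B)\vee C\}$; $\mathsf{mix}$: $S\{A\wedge B\}\Rightarrow S\{A\vee B\}$; $\exists$: $S\{A[x/t]\}\Rightarrow S\{\exists x.A\}$; $\equiv$: $S\{B\}\Rightarrow S\{A\}$ if $A\equiv B$; $\mathsf w$: $S\{A\}\Rightarrow S\{A\vee B\}$; $\mathsf m$: $S\{(A\wedge C)\vee(B\wedge D)\}\Rightarrow S\{(A\vee B)\wedge(C\vee D)\}$; $\mathsf{ac}$: $S\{a\vee a\}\Rightarrow S\{a\}$ ($a$ an atom); $\mathsf m_\forall$: $S\{(\forall x.A)\vee(\forall x.B)\}\Rightarrow S\{\forall x.(A\vee B)\}$; $\mathsf m_\exists$: $S\{(\exists x.A)\vee(\exists x.B)\}\Rightarrow S\{\exists x.(A\vee B)\}$; $\mathsf w_\forall$: $S\{A\}\Rightarrow S\{\forall x.A\}$ ($x$ not free in $A$); $\mathsf c_\forall$: $S\{\forall x.\forall x.A\}\Rightarrow S\{\forall x.A\}$; and general contraction $\mathsf c$: $S\{A\vee A\}\Rightarrow S\{A\}$. $\mathsf{KS1}$ consists of all rules listed except $\mathsf c$; $\mathsf{MLS1^X}$ consists of the rules $\forall,\mathsf{ai},\mathsf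 t\text{-rule},\mathsf s,\mathsf{mix},\exists,\equiv$.
   Formalization: Formulas are taken up to renaming of bound variables: the equivalence ≡, and so the rule ≡ in all three systems, also includes such renaming; without it the claim fails, e.g. for (∀x.∃z.s(z)) ∨ s̄(x). *)

(* Defs.v *)
From mathcomp Require Import all_boot.

Set Implicit Arguments.
Unset Strict Implicit.
Unset Printing Implicit Defensive.

Definition infinite (T : eqType) : Prop := forall s : seq T, exists x, x \notin s.

(* The set of predicate symbols is closed under the duality p |-> \bar p, so an
   atom \bar p(t_1, ..., t_n) is the application of the symbol [pdual p]. *)
Record signature : Type := Signature {
  var : countType;
  fsym : countType;
  psym : countType;
  farity : fsym -> nat;
  parity : psym -> nat;
  pdual : psym -> psym;
  pdual_arity : forall p, parity (pdual p) = parity p;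
  pdualK : forall p, pdual (pdual p) = p;
  pdual_neq : forall p, pdual p <> p;
  var_infinite : infinite var;
  fsym_infinite : infinite fsym;
  psym_infinite : infinite psym
}.

Section Syntax.

Variable Sg : signature.

Inductive term : Type :=
| Var (x : var Sg)
| App (f : fsym Sg) (ts : {ffun 'I_(farity f) -> term}).

Inductive atom : Type :=
| ATrue
| AFalse
| APred (p : psym Sg) (ts : {ffun 'I_(parity p) -> term}).

Inductive formula : Type :=
| Atom (a : atom)
| And (A B : formula)
| Or (A B : formula)
| Ex (x : var Sg) (A : formula)
| All (x : var Sg) (A : formula).

Definition ftrue : formula := Atom ATrue.

Definition neg_atom (a : atom) : atom :=
  match a with
  | ATrue => AFalse
  | AFalse => ATrue
  | APred p ts =>
      @APred (pdual p) [ffun i => ts (cast_ord (pdual_arity p) i)]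
  end.

Fixpoint occurs (x : var Sg) (t : term) : bool :=
  match t with
  | Var y => x == y
  | App f ts => [exists i, occurs x (ts i)]
  end.

Definition occurs_atom (x : var Sg) (a : atom) : bool :=
  match a with
  | ATrue | AFalse => false
  | APred p ts => [exists i, occurs x (ts i)]
  end.

Fixpoint free (x : var Sg) (A : formula) : bool :=
  match A with
  | Atom a => occurs_atom x a
  | And B C | Or B C => free x B || free x C
  | Ex y B | All y B => (x != y) && free x B
  end.

Fixpoint subst_term (x : var Sg) (u : term) (t : term) : term :=
  match t with
  | Var y => if x == y then u else Var y
  | App f ts => App [ffun i => subst_term x u (ts i)]
  end.

Definition subst_atom (x : var Sg) (u : term) (a : atom) : atom :=
  match a with
  | ATrue => ATrue
  | AFalse => AFalse
  | APred p ts => APred [ffun i => subst_term x u (ts i)]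
  end.

(* A[x/u] without renaming of bound variables; it is only used under the
   hypothesis [free_for u x A], which excludes variable capture. *)
Fixpoint subst (x : var Sg) (u : term) (A : formula) : formula :=
  match A with
  | Atom a => Atom (subst_atom x u a)
  | And B C => And (subst x u B) (subst x u C)
  | Or B C => Or (subst x u B) (subst x u C)
  | Ex y B => if x == y then Ex y B else Ex y (subst x u B)
  | All y B => if x == y then All y B else All y (subst x u B)
  end.

Fixpoint free_for (u : term) (x : var Sg) (A : formula) : bool :=
  match A with
  | Atom _ => true
  | And B C | Or B C => free_for u x B && free_for u x C
  | Ex y B | All y B =>
      [|| x == y, ~~ free x B | ~~ occurs y u && free_for u x B]
  end.

(* Formulas are taken up to renaming of bound variables.  On the named syntax
   this identification is the pair of clauses [equiv_ren_ex], [equiv_ren_all]. *)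
Inductive equiv : formula -> formula -> Prop :=
| equiv_refl A : equiv A A
| equiv_sym A B : equiv A B -> equiv B A
| equiv_trans A B C : equiv A B -> equiv B C -> equiv A C
| equiv_and A A' B B' : equiv A A' -> equiv B B' -> equiv (And A B) (And A' B')
| equiv_or A A' B B' : equiv A A' -> equiv B B' -> equiv (Or A B) (Or A' B')
| equiv_ex x A A' : equiv A A' -> equiv (Ex x A) (Ex x A')
| equiv_all x A A' : equiv A A' -> equiv (All x A) (All x A')
| equiv_andC A B : equiv (And A B) (And B A)
| equiv_orC A B : equiv (Or A B) (Or B A)
| equiv_andA A B C : equiv (And A (And B C)) (And (And A B) C)
| equiv_orA A B C : equiv (Or A (Or B C)) (Or (Or A B) C)
| equiv_allC x y A : equiv (All x (All y A)) (All y (All x A))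
| equiv_exC x y A : equiv (Ex x (Ex y A)) (Ex y (Ex x A))
| equiv_all_or x A B : ~~ free x B -> equiv (All x (Or A B)) (Or (All x A) B)
| equiv_ex_and x A B : ~~ free x B -> equiv (Ex x (And A B)) (And (Ex x A) B)
| equiv_ren_ex x y A : ~~ free y A -> free_for (Var y) x A ->
    equiv (Ex x A) (Ex y (subst x (Var y) A))
| equiv_ren_all x y A : ~~ free y A -> free_for (Var y) x A ->
    equiv (All x A) (All y (subst x (Var y) A)).

Inductive ctx : Type :=
| Hole
| CAndL (K : ctx) (B : formula)
| CAndR (A : formula) (K : ctx)
| COrL (K : ctx) (B : formula)
| COrR (A : formula) (K : ctx)
| CEx (x : var Sg) (K : ctx)
| CAll (x : var Sg) (K : ctx).

(* Filling the hole may capture free variables of [A]. *)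
Fixpoint fill (K : ctx) (A : formula) : formula :=
  match K with
  | Hole => A
  | CAndL K B => And (fill K A) B
  | CAndR B K => And B (fill K A)
  | COrL K B => Or (fill K A) B
  | COrR B K => Or B (fill K A)
  | CEx x K => Ex x (fill K A)
  | CAll x K => All x (fill K A)
  end.

Inductive rule : Type :=
| r_all | r_ai | r_t | r_s | r_mix | r_ex | r_equiv
| r_w | r_m | r_ac | r_mall | r_mex | r_wall | r_call | r_c.

(* [inference r P C]: P => C is an instance of r in the empty context. *)
Inductive inference : rule -> formula -> formula -> Prop :=
| i_all x : inference r_all ftrue (All x ftrue)
| i_ai a : inference r_ai ftrue (Or (Atom a) (Atom (neg_atom a)))
| i_t A : inference r_t A (And A ftrue)
| i_s A B C : inference r_s (And A (Or B C)) (Or (And A B) C)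
| i_mix A B : inference r_mix (And A B) (Or A B)
| i_ex x u A : free_for u x A -> inference r_ex (subst x u A) (Ex x A)
| i_equiv A B : equiv A B -> inference r_equiv B A
| i_w A B : inference r_w A (Or A B)
| i_m A B C D : inference r_m (Or (And A C) (And B D)) (And (Or A B) (Or C D))
| i_ac a : inference r_ac (Or (Atom a) (Atom a)) (Atom a)
| i_mall x A B : inference r_mall (Or (All x A) (All x B)) (All x (Or A B))
| i_mex x A B : inference r_mex (Or (Ex x A) (Ex x B)) (Ex x (Or A B))
| i_wall x A : ~~ free x A -> inference r_wall A (All x A)
| i_call x A : inference r_call (All x (All x A)) (All x A)
| i_c A : inference r_c (Or A A) A.

Definition step (R : pred rule) (P C : formula) : Prop :=
  exists r (K : ctx) (A B : formula),
    [/\ R r, inference r A B, P = fill K A & C = fill K B].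

Inductive derivation (R : pred rule) : formula -> formula -> Prop :=
| der_nil A : derivation R A A
| der_cons A B C : step R A B -> derivation R B C -> derivation R A C.

Fixpoint false_free (A : formula) : bool :=
  match A with
  | Atom AFalse => false
  | Atom _ => true
  | And B C | Or B C => false_free B && false_free C
  | Ex _ B | All _ B => false_free B
  end.

End Syntax.

Arguments ftrue {Sg}.

Definition KS1 : pred rule :=
  fun r => match r with r_c => false | _ => true end.

Definition MLS1X : pred rule :=
  fun r => match r with
           | r_all | r_ai | r_t | r_s | r_mix | r_ex | r_equiv => true
           | _ => false
           end.

Definition WCE : pred rule :=
  fun r => match r with r_w | r_c | r_equiv => true | _ => false end.

(* Main.v *)
From mathcomp Require Import all_boot.
From Stdlib Require List.
Require Import Defs.

(* Call a finite set [G] of formulas provable when some false-free theorem of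
   MLS1X is a disjunction of formulas each of which becomes a member of [G] by
   weakenings and contractions.  Because weakening and contraction act deeply,
   this notion is closed under all rules of a cut-free one-sided sequent
   calculus.  That every KS1 theorem is provable follows from an algebraic form
   of cut elimination (Okada): with [orth X] the set of those [D] for which
   [G, D] is provable for all [G] in [X], the sets equal to their biorthogonal
   form a Boolean algebra in which KS1 is sound, quantifiers ranging over terms,
   and membership of [G] in the value of [A] makes [A, G] provable.
   Substitution never needs renaming, since the bound variables of the end
   formula are first renamed apart from its free ones, and only terms without
   these variables serve as values. *)

Set Implicit Arguments.
Unset Strict Implicit.
Unset Printing Implicit Defensive.

(** * Syntax and derivations *)

Section Syntax.

Variable Sg : signature.
Implicit Types (x y z : var Sg) (t u : term Sg) (a : atom Sg).
Implicit Types (A B C X Y Z : formula Sg) (G D : seq (formula Sg)).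

(** The arguments of an application sit inside a finite function, so the induction hypothesis for
    each of them is spelled out. *)
Lemma term_nested_ind (P : term Sg -> Prop) :
    (forall x, P (Var x)) ->
    (forall f (ts : {ffun 'I_(farity f) -> term Sg}),
       (forall i, P (ts i)) -> P (App ts)) ->
  forall t, P t.
Proof.
move=> PV PA; fix IH 1 => -[x|f ts]; first exact: PV.
by apply: PA => i; exact: IH.
Qed.

Lemma subst_term_id x u t : ~~ occurs x t -> subst_term x u t = t.
Proof.
elim/term_nested_ind: t => [y /negbTE /= ->|f ts IH] //=.
rewrite negb_exists => /forallP nx; congr App.
by apply/ffunP => i; rewrite ffunE; exact: IH.
Qed.

Lemma subst_id x u A : ~~ free x A -> subst x u A = A.
Proof.
elim: A => [[||p ts]|B IB C IC|B IB C IC|y B IB|y B IB] //=.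
- rewrite negb_exists => /forallP nx; congr (Atom (APred _)).
  by apply/ffunP => i; rewrite ffunE subst_term_id.
- by rewrite negb_or => /andP[/IB -> /IC ->].
- by rewrite negb_or => /andP[/IB -> /IC ->].
- by case: eqVneq => //= _ /IB ->.
- by case: eqVneq => //= _ /IB ->.
Qed.

Lemma occurs_subst_term z x u t :
  occurs z (subst_term x u t) -> (z != x) && occurs z t || occurs z u.
Proof.
elim/term_nested_ind: t => [y|f ts IH] /=.
  case: (eqVneq x y) => [_ ->|xy /= /eqP ->]; first by rewrite orbT.
  by rewrite eqxx andbT eq_sym xy.
case/existsP=> i; rewrite ffunE => /IH /orP[/andP[-> zi]|->]; rewrite ?orbT //.
by apply/orP; left; apply/existsP; exists i.
Qed.

Lemma free_subst z x u A :
  free z (subst x u A) -> (z != x) && free z A || occurs z u.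
Proof.
elim: A => [[||p ts]|B IB C IC|B IB C IC|y B IB|y B IB] //=.
- case/existsP=> i; rewrite ffunE => /occurs_subst_term.
  case/orP=> [/andP[-> zi]|->]; rewrite ?orbT //.
  by apply/orP; left; apply/existsP; exists i.
- by case/orP=> [/IB|/IC] /orP[/andP[-> ->]|->]; rewrite ?orbT.
- by case/orP=> [/IB|/IC] /orP[/andP[-> ->]|->]; rewrite ?orbT.
- by case: eqVneq => [->|xy] /= /andP[->] // ->.
- by case: eqVneq => [->|xy] /= /andP[->] // ->.
Qed.

(** Terms do not count, so this measure is invariant under substitution and an induction on it can
    pass from a quantified formula to instances of its body. *)
Fixpoint fsize A : nat :=
  match A with
  | Atom _ => 0
  | And B C | Or B C => (fsize B + fsize C).+1
  | Ex _ B | All _ B => (fsize B).+1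
  end.

Lemma fsize_subst x u A : fsize (subst x u A) = fsize A.
Proof.
by elim: A => //= [B -> C ->|B -> C ->|y B IB|y B IB] //; case: ifP => //= _; rewrite IB.
Qed.

Fixpoint bvars A : seq (var Sg) :=
  match A with
  | Atom _ => [::]
  | And B C | Or B C => bvars B ++ bvars C
  | Ex x B | All x B => x :: bvars B
  end.

Lemma bvars_subst x u A : bvars (subst x u A) = bvars A.
Proof.
by elim: A => //= [B -> C ->|B -> C ->|y B IB|y B IB] //; case: ifP => //= _; rewrite IB.
Qed.

Lemma free_for_bvars u x A :
  {in bvars A, forall y, ~~ occurs y u} -> free_for u x A.
Proof.
elim: A => //= [B IB C IC|B IB C IC|y B IB|y B IB] nu.
- by rewrite IB ?IC // => y yB; apply: nu; rewrite mem_cat yB ?orbT.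
- by rewrite IB ?IC // => y yB; apply: nu; rewrite mem_cat yB ?orbT.
- rewrite nu ?mem_head // IB ?orbT // => z zB.
  by apply: nu; rewrite inE zB orbT.
- rewrite nu ?mem_head // IB ?orbT // => z zB.
  by apply: nu; rewrite inE zB orbT.
Qed.

Lemma term_vars_finite t : exists s : seq (var Sg), forall x, occurs x t -> x \in s.
Proof.
elim/term_nested_ind: t => [y|f ts IH].
  by exists [:: y] => x /=; rewrite inE.
have [s Hs] := fin_all_exists IH.
exists (flatten [seq s i | i <- enum 'I_(farity f)]) => x /= /existsP[i xi].
by apply/flattenP; exists (s i); [apply: map_f; rewrite mem_enum | exact: Hs].
Qed.

Lemma free_vars_finite A : exists s : seq (var Sg), forall x, free x A -> x \in s.
Proof.
elim: A => [[||p ts]|B [s Hs] C [r Hr]|B [s Hs] C [r Hr]|y B [s Hs]|y B [s Hs]] /=.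
- by exists [::].
- by exists [::].
- have [s Hs] := fin_all_exists (fun i => term_vars_finite (ts i)).
  exists (flatten [seq s i | i <- enum 'I_(parity p)]) => x /existsP[i xi].
  by apply/flattenP; exists (s i); [apply: map_f; rewrite mem_enum | exact: Hs].
- by exists (s ++ r) => x; rewrite mem_cat => /orP[/Hs ->|/Hr ->]; rewrite ?orbT.
- by exists (s ++ r) => x; rewrite mem_cat => /orP[/Hs ->|/Hr ->]; rewrite ?orbT.
- by exists s => x /andP[_ /Hs].
- by exists s => x /andP[_ /Hs].
Qed.

Lemma exists_fresh G (s : seq (var Sg)) :
  exists2 y, y \notin s & forall A, List.In A G -> ~~ free y A.
Proof.
elim: G s => [|A G IH] s.
  by have [y ys] := @var_infinite Sg s; exists y.
have [r Hr] := free_vars_finite A.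
have [y] := IH (s ++ r); rewrite mem_cat negb_or => /andP[ys yr] HG.
exists y => // B [<-|/HG //].
by apply: contra yr; exact: Hr.
Qed.

Lemma rename_bound (s : seq (var Sg)) A : exists A',
  [/\ equiv A A', {in bvars A', forall x, x \notin s}
    & forall z, free z A' -> free z A].
Proof.
elim: A => [a|B [B' [eB bB fB]] C [C' [eC bC fC]]|B [B' [eB bB fB]] C [C' [eC bC fC]]
           |x B [B' [eB bB fB]]|x B [B' [eB bB fB]]].
- by exists (Atom a); split=> //; exact: equiv_refl.
- exists (And B' C'); split; first exact: equiv_and.
    by move=> x /=; rewrite mem_cat => /orP[/bB|/bC].
  by move=> z /= /orP[/fB ->|/fC ->]; rewrite ?orbT.
- exists (Or B' C'); split; first exact: equiv_or.
    by move=> x /=; rewrite mem_cat => /orP[/bB|/bC].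
  by move=> z /= /orP[/fB ->|/fC ->]; rewrite ?orbT.
(* Avoiding [bvars B'] makes [y] substitutable for [x], and avoiding the free variables of [B']
   makes the renaming an instance of [equiv]. *)
- have [y] := exists_fresh [:: B'] (s ++ bvars B').
  rewrite mem_cat negb_or => /andP[ys yB] /(_ _ (or_introl erefl)) yf.
  exists (Ex y (subst x (Var y) B')); split.
  + apply: equiv_trans (equiv_ex x eB) _; apply: equiv_ren_ex => //.
    by apply: free_for_bvars => z zB /=; apply: contraNneq yB => <-.
  + by move=> z; rewrite /= bvars_subst inE => /orP[/eqP ->|/bB].
  + move=> z /= /andP[zy /free_subst /=].
    by rewrite (negbTE zy) orbF => /andP[-> /fB].
- have [y] := exists_fresh [:: B'] (s ++ bvars B').
  rewrite mem_cat negb_or => /andP[ys yB] /(_ _ (or_introl erefl)) yf.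
  exists (All y (subst x (Var y) B')); split.
  + apply: equiv_trans (equiv_all x eB) _; apply: equiv_ren_all => //.
    by apply: free_for_bvars => z zB /=; apply: contraNneq yB => <-.
  + by move=> z; rewrite /= bvars_subst inE => /orP[/eqP ->|/bB].
  + move=> z /= /andP[zy /free_subst /=].
    by rewrite (negbTE zy) orbF => /andP[-> /fB].
Qed.

(** * Derivations inside contexts *)

Lemma derivation_trans R A B C :
  derivation R A B -> derivation R B C -> derivation R A C.
Proof. by elim=> // A1 A2 A3 st _ IH /IH; exact: der_cons. Qed.

Lemma derivation_step (R : pred rule) r A B :
  R r -> inference r A B -> derivation R A B.
Proof.
move=> Rr rAB; apply: der_cons (der_nil R B).
by exists r, (Hole Sg), A, B.
Qed.

(** An operation that commutes with filling a hole carries each step to a step in another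
    context. *)
Lemma derivation_map R (f : formula Sg -> formula Sg) (k : ctx Sg -> ctx Sg) :
    (forall K A, f (fill K A) = fill (k K) A) ->
  forall A B, derivation R A B -> derivation R (f A) (f B).
Proof.
move=> fk A B; elim=> [C|A1 A2 A3 [r [K [C [D [Rr i -> ->]]]]] _].
  exact: der_nil.
by apply: der_cons; exists r, (k K), C, D; rewrite !fk.
Qed.

Lemma derivation_and R A A' B B' :
  derivation R A A' -> derivation R B B' -> derivation R (And A B) (And A' B').
Proof.
move=> dA dB; apply: (@derivation_trans _ _ (And A' B)).
  by apply: (@derivation_map _ (fun X => And X B) (fun K => CAndL K B)).
by apply: (@derivation_map _ (And A') (CAndR A')).
Qed.

Lemma derivation_or R A A' B B' :
  derivation R A A' -> derivation R B B' -> derivation R (Or A B) (Or A' B').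
Proof.
move=> dA dB; apply: (@derivation_trans _ _ (Or A' B)).
  by apply: (@derivation_map _ (fun X => Or X B) (fun K => COrL K B)).
by apply: (@derivation_map _ (Or A') (COrR A')).
Qed.

Lemma derivation_ex R x A A' :
  derivation R A A' -> derivation R (Ex x A) (Ex x A').
Proof. exact: (@derivation_map _ (Ex x) (@CEx _ x)). Qed.

Lemma derivation_all R x A A' :
  derivation R A A' -> derivation R (All x A) (All x A').
Proof. exact: (@derivation_map _ (All x) (@CAll _ x)). Qed.

Lemma derivation_equiv (R : pred rule) A B :
  R r_equiv -> equiv A B -> derivation R A B.
Proof. by move=> Re /equiv_sym e; apply: (derivation_step Re); exact: i_equiv. Qed.

(* The weakenings and contractions turning [X] into [A], organised along the
   structure of [A] so that they can be lifted along a substitution. *)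
Inductive refines : formula Sg -> formula Sg -> Prop :=
| refines_atom a : refines (Atom a) (Atom a)
| refines_and X A Y B : refines X A -> refines Y B -> refines (And X Y) (And A B)
| refines_orl X A B : refines X A -> refines X (Or A B)
| refines_orr X A B : refines X B -> refines X (Or A B)
| refines_ex x X A : refines X A -> refines (Ex x X) (Ex x A)
| refines_all x X A : refines X A -> refines (All x X) (All x A)
| refines_contr X Y A : refines X A -> refines Y A -> refines (Or X Y) A.

Lemma refines_derivation X A : refines X A -> derivation WCE X A.
Proof.
elim=> {X A} [a|X A Y B _ dA _ dB|X A B _ d|X A B _ d|x X A _ d|x X A _ d|X Y A _ dX _ dY].
- exact: der_nil.
- exact: derivation_and.
- by apply: derivation_trans d _; apply: derivation_step (i_w A B).
- apply: derivation_trans d _.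
  apply: derivation_trans (derivation_step _ (i_w B A)) _ => //.
  by apply: derivation_equiv => //; exact: equiv_orC.
- exact: derivation_ex.
- exact: derivation_all.
- apply: derivation_trans (derivation_or dX dY) _.
  exact: derivation_step (i_c A).
Qed.

Lemma refines_free X A z : refines X A -> free z X -> free z A.
Proof.
elim=> {X A} //= [X A Y B _ fA _ fB|X A B _ f|X A B _ f|x X A _ f|x X A _ f|X Y A _ fX _ fY].
- by case/orP=> [/fA ->|/fB ->]; rewrite ?orbT.
- by move/f ->.
- by move/f ->; rewrite orbT.
- by case/andP=> -> /f.
- by case/andP=> -> /f.
- by case/orP.
Qed.

(** [X] is assembled from copies of parts of [A[x/u]], and each copy is replaced by the part of [A]
    it comes from. That [u] is free for [x] in [X'] permits the existential rule and the renaming of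
    bound variables there. *)
Lemma refines_subst x u X A : free_for u x A -> refines X (subst x u A) ->
  exists X', [/\ X = subst x u X', refines X' A & free_for u x X'].
Proof.
move=> ff r; move Es: (subst x u A) r => As r.
elim: r A ff Es => {X As}
  [a|X A Y B _ IA _ IB|X A B _ IA|X A B _ IA|y X A r IA|y X A r IA|X Y A _ IX _ IY].
(* Substitution keeps the outermost constructor, which excludes all other shapes of the formula
   before substitution. *)
- case=> [b|A' B'|A' B'|z A'|z A'] //=; try by case: ifP.
  by move=> _ [<-]; exists (Atom b); split=> //; exact: refines_atom.
- case=> [b|A' B'|A' B'|z A'|z A'] //=; try by case: ifP.
  case/andP=> fA fB [/(IA _ fA)[X' [-> rX fX]] /(IB _ fB)[Y' [-> rY fY]]].
  by exists (And X' Y'); split=> //=; [exact: refines_and|rewrite fX].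
- case=> [b|A' B'|A' B'|z A'|z A'] //=; try by case: ifP.
  case/andP=> fA fB [/(IA _ fA)[X' [-> rX fX]] _].
  by exists X'; split=> //; exact: refines_orl.
- case=> [b|A' B'|A' B'|z A'|z A'] //=; try by case: ifP.
  case/andP=> fA fB [_ /(IA _ fB)[X' [-> rX fX]]].
  by exists X'; split=> //; exact: refines_orr.
- case=> [b|A' B'|A' B'|z A'|z A'] //=; try by case: ifP.
  case: (eqVneq x z) => [<-|xz] /=.
    (* The binder is [x] itself, so nothing is substituted below it. *)
    move=> _ [? ?]; subst y A'; exists (Ex x X).
    by rewrite /= eqxx; split=> //; exact: refines_ex.
  case: (boolP (free x A')) => /= [_ /andP[zu fA]|nx _] [? EA]; subst z.
    have [X' [-> rX fX]] := IA _ fA EA.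
    exists (Ex y X'); rewrite /= (negbTE xz) zu fX !orbT.
    by split=> //; exact: refines_ex.
  (* Here [y] may occur in [u]; nothing is captured because [x] is not free in [X] either. *)
  rewrite subst_id // in EA; subst A'.
  have nX: ~~ free x X by apply: contra nx; exact: refines_free.
  exists (Ex y X); rewrite /= (negbTE xz) subst_id //= nX; split=> //.
  exact: refines_ex.
- case=> [b|A' B'|A' B'|z A'|z A'] //=; try by case: ifP.
  case: (eqVneq x z) => [<-|xz] /=.
    move=> _ [? ?]; subst y A'; exists (All x X).
    by rewrite /= eqxx; split=> //; exact: refines_all.
  case: (boolP (free x A')) => /= [_ /andP[zu fA]|nx _] [? EA]; subst z.
    have [X' [-> rX fX]] := IA _ fA EA.
    exists (All y X'); rewrite /= (negbTE xz) zu fX !orbT.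
    by split=> //; exact: refines_all.
  rewrite subst_id // in EA; subst A'.
  have nX: ~~ free x X by apply: contra nx; exact: refines_free.
  exists (All y X); rewrite /= (negbTE xz) subst_id //= nX; split=> //.
  exact: refines_all.
- move=> A' ff EA.
  have [X' [-> rX fX]] := IX _ ff EA; have [Y' [-> rY fY]] := IY _ ff EA.
  by exists (Or X' Y'); split=> //=; [exact: refines_contr|rewrite fX].
Qed.

End Syntax.

(** * Provable sets of formulas *)

Section Provability.

Variable Sg : signature.
Implicit Types (x y z : var Sg) (t u : term Sg) (a : atom Sg).
Implicit Types (A B C X Y Z : formula Sg) (G D : seq (formula Sg)).

(** Only outermost disjunctions are split, and each leaf may refine any member, so order and
    multiplicity in [G] do not matter. *)
Inductive covers G : formula Sg -> Prop :=
| covers_member X A : List.In A G -> refines X A -> covers G X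
| covers_or X Y : covers G X -> covers G Y -> covers G (Or X Y).

Lemma covers_incl G D X : List.incl G D -> covers G X -> covers D X.
Proof.
move=> GD; elim=> [Y A /GD AD r|Y Z _ cY _ cZ]; first exact: covers_member AD r.
exact: covers_or.
Qed.

Lemma covers_free G X z : covers G X -> (forall A, List.In A G -> ~~ free z A) ->
  ~~ free z X.
Proof.
move=> c nG; elim: c => [Y A /nG nA r|Y Z _ nY _ nZ] /=.
  by apply: contra nA; exact: refines_free.
by rewrite negb_or nY.
Qed.

(** The leaves refining [A] are gathered into a disjunction [Y], which refines [A] by contraction;
    the others form [Z]. Either group may be empty, and there is no empty disjunction, hence three
    cases. *)
Lemma covers_cons A G X : covers (A :: G) X -> false_free X ->
  [\/ covers G X, refines X A
    | exists Y Z, [/\ equiv X (Or Y Z), false_free Y, false_free Z,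
                      refines Y A & covers G Z]].
Proof.
elim=> {X} [X C [<- r|CG r] _|X1 X2 _ IH1 _ IH2 /= /andP[f1 f2]].
- exact: Or32.
- by apply: Or31; exact: covers_member CG r.
- case: (IH1 f1) => [c1|r1|[Y1 [Z1 [e1 fY1 fZ1 r1 c1]]]];
    case: (IH2 f2) => [c2|r2|[Y2 [Z2 [e2 fY2 fZ2 r2 c2]]]].
  + by apply: Or31; exact: covers_or.
  + by apply: Or33; exists X2, X1; split=> //; exact: equiv_orC.
  + apply: Or33; exists Y2, (Or Z2 X1); split=> //=; try by rewrite ?fZ2.
      apply: equiv_trans (equiv_orC _ _) _; apply: equiv_sym.
      apply: equiv_trans (equiv_orA _ _ _) _.
      by apply: equiv_or; [exact: equiv_sym|exact: equiv_refl].
    exact: covers_or.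
  + by apply: Or33; exists X1, X2; split=> //; exact: equiv_refl.
  + by apply: Or32; exact: refines_contr.
  + apply: Or33; exists (Or X1 Y2), Z2; split=> //=; try by rewrite ?f1.
      apply: equiv_trans (equiv_or (equiv_refl _) e2) _; exact: equiv_orA.
    exact: refines_contr.
  + apply: Or33; exists Y1, (Or Z1 X2); split=> //=; try by rewrite ?fZ1.
      apply: equiv_trans (equiv_or e1 (equiv_refl _)) _.
      by apply: equiv_sym; exact: equiv_orA.
    exact: covers_or.
  + apply: Or33; exists (Or Y1 X2), Z1; split=> //=; try by rewrite ?fY1.
      apply: equiv_trans (equiv_or e1 (equiv_refl _)) _.
      apply: equiv_trans (equiv_sym (equiv_orA _ _ _)) _.
      apply: equiv_trans (equiv_or (equiv_refl _) (equiv_orC _ _)) _.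
      exact: equiv_orA.
    exact: refines_contr.
  (* Both parts split, and the four pieces are regrouped by exchanging [Z1] and [Y2]. *)
  + apply: Or33; exists (Or Y1 Y2), (Or Z1 Z2); split=> /=; rewrite ?fY1 ?fZ1 //.
    * apply: equiv_trans (equiv_or e1 e2) _.
      apply: equiv_trans (equiv_orA _ _ _) _.
      apply: equiv_sym; apply: equiv_trans (equiv_orA _ _ _) _.
      apply: equiv_or (equiv_refl _).
      apply: equiv_trans (equiv_sym (equiv_orA _ _ _)) _.
      apply: equiv_trans (equiv_or (equiv_refl _) (equiv_orC _ _)) _.
      exact: equiv_orA.
    * exact: refines_contr.
    * exact: covers_or.
Qed.

(** * Closure of provability under sequent rules *)

Definition provable G : Prop :=
  exists X, [/\ false_free X, derivation MLS1X ftrue X & covers G X].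

Lemma provable_incl G D : List.incl G D -> provable G -> provable D.
Proof.
by move=> GD [X [f d c]]; exists X; split=> //; exact: covers_incl c.
Qed.

(** Rules act at any depth, so each leaf refining [A] is transformed where it stands while the
    leaves refining members of [G] are left alone. *)
Lemma provable_map A B G :
    (forall Y, false_free Y -> refines Y A -> exists Y',
       [/\ false_free Y', derivation MLS1X Y Y' & refines Y' B]) ->
  provable (A :: G) -> provable (B :: G).
Proof.
move=> AB [X [f d c]].
suff [X' [f' d' c']] : exists X', [/\ false_free X', derivation MLS1X X X'
    & covers (B :: G) X'].
  by exists X'; split=> //; exact: derivation_trans d d'.
elim: c f {d} => {X} [X C [<- r|CG r] f|X Y _ IX _ IY /= /andP[fX fY]].
- have [Y' [f' d' r']] := AB X f r.
  by exists Y'; split=> //; apply: covers_member r'; left.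
- exists X; split=> //; first exact: der_nil.
  by apply: covers_member r; right.
- have [X' [fX' dX cX]] := IX fX; have [Y' [fY' dY cY]] := IY fY.
  exists (Or X' Y'); split=> /=; first by rewrite fX'.
    exact: derivation_or.
  exact: covers_or.
Qed.

Lemma provable_orl A B G : provable (A :: G) -> provable (Or A B :: G).
Proof.
apply: provable_map => Y f r; exists Y.
by split=> //; [exact: der_nil|exact: refines_orl].
Qed.

Lemma provable_orr A B G : provable (B :: G) -> provable (Or A B :: G).
Proof.
apply: provable_map => Y f r; exists Y.
by split=> //; [exact: der_nil|exact: refines_orr].
Qed.

Lemma false_free_subst x u A : false_free (subst x u A) = false_free A.
Proof.
elim: A => [[||p ts]|B IB C IC|B IB C IC|y B IB|y B IB] //=;
  by rewrite ?IB ?IC //; case: ifP.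
Qed.

(** A leaf refining [A[x/u]] is itself an instance [Y'[x/u]] with [Y'] refining [A], so the
    existential rule applies at each leaf separately. *)
Lemma provable_ex x u A G : free_for u x A ->
  provable (subst x u A :: G) -> provable (Ex x A :: G).
Proof.
move=> fu; apply: provable_map => Y f r.
have [Y' [EY r' fu']] := refines_subst fu r; subst Y.
exists (Ex x Y'); split; first by rewrite /= -(false_free_subst x u).
  by apply: (@derivation_step _ _ r_ex) => //; exact: i_ex.
exact: refines_ex.
Qed.

(** The whole theorem is generalised over the eigenvariable [y]; the quantifier is then confined to
    the part refining the instance and renamed to [x]. *)
Lemma provable_all x y A G :
    free_for (Var y) x A -> ~~ free y A ->
    (forall B, List.In B G -> ~~ free y B) ->
  provable (subst x (Var y) A :: G) -> provable (All x A :: G).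
Proof.
move=> fu yA yG [X [f d c]].
have dall : derivation MLS1X ftrue (All y X).
  apply: derivation_trans (derivation_all y d).
  exact: derivation_step (i_all y).
have fold Y : refines Y (subst x (Var y) A) -> exists Y',
    [/\ false_free Y' = false_free Y, equiv (All y Y) (All x Y') & refines Y' A].
  move=> /(refines_subst fu)[Y' [-> r fu']]; exists Y'.
  split=> //; first by rewrite false_free_subst.
  apply: equiv_sym; apply: equiv_ren_all => //.
  by apply: contra yA; exact: refines_free.
case: (covers_cons c f) => [{}c|/fold[Y' [fY' eY' r]]|].
- by exists X; split=> //; apply: covers_incl c => B; right.
- exists (All x Y'); split; first by rewrite /= fY'.
    exact: derivation_trans dall (derivation_equiv _ eY').
  by apply: covers_member (refines_all x r); left.
- move=> [Y [Z [eX fY fZ /fold[Y' [fY' eY' r]] {}c]]].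
  exists (Or (All x Y') Z); split; first by rewrite /= fY' fY.
    apply: derivation_trans dall (derivation_equiv _ _) => //.
    apply: equiv_trans (equiv_all y eX) _.
    (* The part [Z] covers [G], so [y] is not free in it. *)
    apply: equiv_trans (equiv_all_or _ _) _; first exact: covers_free c yG.
    exact: equiv_or eY' (equiv_refl _).
  apply: covers_or; first by apply: covers_member (refines_all x r); left.
  by apply: covers_incl c => B; right.
Qed.

Lemma derivation_switch X Y Z : derivation MLS1X (And X (Or Y Z)) (Or (And X Y) Z).
Proof. exact: derivation_step (i_s X Y Z). Qed.

Lemma derivation_switchl X Y Z : derivation MLS1X (And (Or X Z) Y) (Or (And X Y) Z).
Proof.
apply: derivation_trans (derivation_equiv _ (equiv_andC _ _)) _ => //.
apply: derivation_trans (derivation_switch _ _ _) _.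
apply: derivation_equiv => //.
exact: equiv_or (equiv_andC _ _) (equiv_refl _).
Qed.

(** The two theorems are conjoined, and switch moves the parts covering [G] out of the conjunction.
    A theorem without a part refining its conjunct already covers [G]. *)
Lemma provable_and A B G :
  provable (A :: G) -> provable (B :: G) -> provable (And A B :: G).
Proof.
move=> [X1 [f1 d1 c1]] [X2 [f2 d2 c2]].
have sG X : covers G X -> covers (And A B :: G) X.
  by apply: covers_incl => C; right.
have d : derivation MLS1X ftrue (And X1 X2).
  apply: derivation_trans (derivation_and d1 d2).
  exact: derivation_step (i_t ftrue).
have head X Y : refines X A -> refines Y B -> covers (And A B :: G) (And X Y).
  by move=> rX rY; apply: covers_member (refines_and rX rY); left.
case: (covers_cons c1 f1) => [{}c1|r1|[Y1 [Z1 [e1 fY1 fZ1 r1 {}c1]]]].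
- by exists X1; split=> //; exact: sG.
- case: (covers_cons c2 f2) => [{}c2|r2|[Y2 [Z2 [e2 fY2 fZ2 r2 {}c2]]]].
  + by exists X2; split=> //; exact: sG.
  + by exists (And X1 X2); split; rewrite /= ?f1 //; exact: head.
  + exists (Or (And X1 Y2) Z2); split; first by rewrite /= f1 fY2.
      apply: derivation_trans d _.
      apply: derivation_trans (derivation_switch _ _ _).
      apply: derivation_and; first exact: der_nil.
      exact: derivation_equiv.
    by apply: covers_or; [exact: head|exact: sG].
- case: (covers_cons c2 f2) => [{}c2|r2|[Y2 [Z2 [e2 fY2 fZ2 r2 {}c2]]]].
  + by exists X2; split=> //; exact: sG.
  + exists (Or (And Y1 X2) Z1); split; first by rewrite /= fY1 f2.
      apply: derivation_trans d _.
      apply: derivation_trans (derivation_switchl _ _ _).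
      apply: derivation_and; last exact: der_nil.
      exact: derivation_equiv.
    by apply: covers_or; [exact: head|exact: sG].
  + exists (Or (Or (And Y1 Y2) Z1) Z2); split; first by rewrite /= fY1 fY2 fZ1.
      apply: derivation_trans d _.
      apply: derivation_trans
        (derivation_and (derivation_equiv _ e1) (derivation_equiv _ e2)) _ => //.
      apply: derivation_trans (derivation_switch _ _ _) _.
      apply: derivation_or; last exact: der_nil.
      exact: derivation_switchl.
    by apply: covers_or; [apply: covers_or; [exact: head|exact: sG]|exact: sG].
Qed.

Lemma provable_true G : List.In ftrue G -> provable G.
Proof.
move=> tG; exists ftrue; split=> //; first exact: der_nil.
exact: covers_member tG (refines_atom _).
Qed.

Lemma provable_dual p (ts : {ffun 'I_(parity p) -> term Sg}) G :
    List.In (Atom (APred ts)) G -> List.In (Atom (neg_atom (APred ts))) G ->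
  provable G.
Proof.
move=> aG nG; exists (Or (Atom (APred ts)) (Atom (neg_atom (APred ts)))).
split=> //; first exact: derivation_step (i_ai _).
by apply: covers_or; [exact: covers_member aG (refines_atom _)
                     |exact: covers_member nG (refines_atom _)].
Qed.

(** With a single member, the outer disjunctions are themselves contractions, so the whole theorem
    refines [A]. *)
Lemma provable_singleton A : provable [:: A] -> exists A',
  [/\ false_free A', derivation MLS1X ftrue A' & derivation WCE A' A].
Proof.
move=> [X [f d c]]; exists X; split=> //; apply: refines_derivation.
by elim: c => [Y B [<-|[]] //|Y Z _ rY _ rZ]; exact: refines_contr.
Qed.

End Provability.

(** * Orthogonality semantics *)

Section Semantics.

Variables (Sg : signature) (bound : seq (var Sg)).
Implicit Types (x y z : var Sg) (t u : term Sg) (a : atom Sg).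
Implicit Types (A B C : formula Sg) (G D E : seq (formula Sg)).
Implicit Types (W X Y Z : seq (formula Sg) -> Prop) (s r : var Sg -> term Sg).

Lemma In_cat A G D : List.In A (G ++ D) <-> List.In A G \/ List.In A D.
Proof. exact: List.in_app_iff. Qed.

Ltac solve_incl :=
  let C := fresh in
  intro C; rewrite /= ?In_cat /=;
  repeat match goal with H : List.incl _ _ |- _ => move: (H C); clear H end;
  rewrite /= ?In_cat /=; tauto.

Definition orth X : seq (formula Sg) -> Prop :=
  fun D => forall G, X G -> provable (G ++ D).

Definition closed X := forall G, orth (orth X) G -> X G.

Lemma orth_orth X G : X G -> orth (orth X) G.
Proof. by move=> XG D /(_ _ XG); apply: provable_incl; solve_incl. Qed.

Lemma closed_orth X : closed (orth X).
Proof. by move=> D ooo G /orth_orth /ooo. Qed.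

Lemma orth_incl X G D : List.incl G D -> orth X G -> orth X D.
Proof.
move=> GD o E /o; apply: provable_incl; solve_incl.
Qed.

Lemma closed_incl X G D : closed X -> List.incl G D -> X G -> X D.
Proof. by move=> cX GD /orth_orth o; apply: cX; exact: orth_incl o. Qed.

Lemma orth_elim X G : orth X G -> X G -> provable G.
Proof. by move=> o /o; apply: provable_incl; solve_incl. Qed.

(** Classical reasoning in the model: membership in a closed set may be refuted by an extension
    orthogonal to it, and provability plays the role of contradiction. *)
Lemma closed_contra X G : closed X ->
  (forall D, List.incl G D -> orth X D -> provable D) -> X G.
Proof.
move=> cX H; apply: cX => D oD; apply: H; first solve_incl.
by apply: orth_incl oD; solve_incl.
Qed.

(** This is the bottom of the algebra: provable sets belong to every closed set. *)
Lemma closed_provable : closed (@provable Sg).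
Proof.
move=> G o; apply: (o [::]) => D; apply: provable_incl; solve_incl.
Qed.

(** The biorthogonal closure of the union, since the orthogonal of a union is the intersection of
    the orthogonals. *)
Definition lor X Y := orth (fun D => orth X D /\ orth Y D).

Lemma lor_l X Y G : X G -> lor X Y G.
Proof. by move=> XG D [/(_ _ XG) + _]; apply: provable_incl; solve_incl. Qed.

Lemma lor_r X Y G : Y G -> lor X Y G.
Proof. by move=> YG D [_ /(_ _ YG)]; apply: provable_incl; solve_incl. Qed.

(** If [D] is orthogonal to [W], the two branches make it orthogonal to [X] and to [Y], hence
    provable as a member of the join. *)
Lemma lor_elim X Y W G : closed X -> closed Y -> closed W -> lor X Y G ->
  (forall D, List.incl G D -> X D -> W D) ->
  (forall D, List.incl G D -> Y D -> W D) -> W G.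
Proof.
move=> cX cY cW o XW YW; apply: (closed_contra cW) => D GD oW.
have {o}oD := orth_incl GD o.
apply: (orth_elim oD); split=> E.
- move=> /(closed_incl cX) XE; apply: (@orth_elim W).
    by apply: orth_incl oW; solve_incl.
  by apply: XW; [|apply: XE]; solve_incl.
- move=> /(closed_incl cY) YE; apply: (@orth_elim W).
    by apply: orth_incl oW; solve_incl.
  by apply: YW; [|apply: YE]; solve_incl.
Qed.

(* Every value avoids the variables in [bound], so that substituting values in
   a formula with bound variables in [bound] captures nothing. *)
Definition value t := forall x, occurs x t -> x \notin bound.

(** The closure of the union of [F t] over all values [t]. *)
Definition lex (F : term Sg -> seq (formula Sg) -> Prop) :=
  orth (fun D => forall t, value t -> orth (F t) D).

Lemma lex_intro F t G : value t -> F t G -> lex F G.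
Proof.
by move=> vt FG D /(_ _ vt _ FG); apply: provable_incl; solve_incl.
Qed.

Lemma lex_elim F W G : (forall t, closed (F t)) -> closed W -> lex F G ->
  (forall t D, value t -> List.incl G D -> F t D -> W D) -> W G.
Proof.
move=> cF cW o FW; apply: (closed_contra cW) => D GD oW.
have {o}oD := orth_incl GD o.
apply: (orth_elim oD) => t vt E /(closed_incl (cF t)) FE.
apply: (@orth_elim W); first by apply: orth_incl oW; solve_incl.
by apply: (FW t) => //; [|apply: FE]; solve_incl.
Qed.

(** The domain of the model consists of terms, so evaluation is simultaneous substitution. *)
Fixpoint eval s t : term Sg :=
  match t with
  | Var x => s x
  | App f ts => App [ffun i => eval s (ts i)]
  end.

Definition eval_atom s a : atom Sg :=
  match a with
  | ATrue => ATrue Sg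
  | AFalse => AFalse Sg
  | APred p ts => APred [ffun i => eval s (ts i)]
  end.

Definition upd s x t : var Sg -> term Sg := fun y => if x == y then t else s y.

(* Exactly one predicate symbol of each dual pair is positive; the other one is
   interpreted as the orthogonal of its dual. *)
Definition positive (p : psym Sg) : bool := pickle p < pickle (pdual p).

Definition interp_atom a : seq (formula Sg) -> Prop :=
  match a with
  | ATrue => fun=> True
  | AFalse => @provable Sg
  | APred p ts =>
      if positive p then orth (eq [:: Atom a])
      else orth (orth (eq [:: Atom (neg_atom a)]))
  end.

(** Intersections of closed sets are closed, so only disjunction and the existential quantifier take
    a closure. *)
Fixpoint interp s A : seq (formula Sg) -> Prop :=
  match A with
  | Atom a => interp_atom (eval_atom s a)
  | And B C => fun G => interp s B G /\ interp s C G
  | Or B C => lor (interp s B) (interp s C)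
  | Ex x B => lex (fun t => interp (upd s x t) B)
  | All x B => fun G => forall t, value t -> interp (upd s x t) B G
  end.

Lemma closed_interp A s : closed (interp s A).
Proof.
elim: A s => [[||p ts]|B IB C IC|B IB C IC|x B IB|x B IB] s //=;
  try exact: closed_orth.
- exact: closed_provable.
- by case: ifP => _; exact: closed_orth.
- move=> G o; split; [apply: IB|apply: IC] => D oD; apply: o => E [BE CE];
    exact: oD.
- by move=> G o t vt; apply: IB => D oD; apply: o => E /(_ _ vt); exact: oD.
Qed.

Lemma lor_mono X X' Y Y' : (forall G, X G -> X' G) -> (forall G, Y G -> Y' G) ->
  forall G, lor X Y G -> lor X' Y' G.
Proof.
by move=> XX YY G o D [oX oY]; apply: o; split=> E; [move/XX/oX|move/YY/oY].
Qed.

Lemma lex_mono F F' : (forall t, value t -> forall G, F t G -> F' t G) ->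
  forall G, lex F G -> lex F' G.
Proof. by move=> FF G o D oF; apply: o => t vt E /(FF t vt) /(oF t vt). Qed.

(** * Assignments and substitution *)

Lemma eval_ext s r t : (forall x, occurs x t -> s x = r x) -> eval s t = eval r t.
Proof.
elim/term_nested_ind: t => [x|f ts IH] /= sr; first by apply: sr; rewrite eqxx.
congr App; apply/ffunP => i; rewrite !ffunE; apply: IH => x xi.
by apply: sr; apply/existsP; exists i.
Qed.

Lemma eval_atom_ext s r a :
  (forall x, occurs_atom x a -> s x = r x) -> eval_atom s a = eval_atom r a.
Proof.
case: a => //= p ts sr; congr APred; apply/ffunP => i; rewrite !ffunE.
by apply: eval_ext => x xi; apply: sr; apply/existsP; exists i.
Qed.

Lemma interp_ext A s r G :
  (forall x, free x A -> s x = r x) -> interp s A G -> interp r A G.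
Proof.
elim: A s r G => [a|B IB C IC|B IB C IC|x B IB|x B IB] s r G /= sr.
- by rewrite (eval_atom_ext sr).
- by case=> iB iC; split; [apply: IB iB|apply: IC iC] => x xf; apply: sr;
    rewrite xf ?orbT.
- by apply: lor_mono => D; [apply: IB|apply: IC] => x xf; apply: sr;
    rewrite xf ?orbT.
- apply: lex_mono => t _ D; apply: IB => z zB; rewrite /upd.
  by case: eqVneq => // xz; apply: sr; rewrite eq_sym xz.
- move=> i t vt; apply: IB (i t vt) => z zB; rewrite /upd.
  by case: eqVneq => // xz; apply: sr; rewrite eq_sym xz.
Qed.

Lemma eval_subst s x u t :
  eval s (subst_term x u t) = eval (upd s x (eval s u)) t.
Proof.
elim/term_nested_ind: t => [y|f ts IH] /=; first by rewrite /upd; case: eqP.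
by congr App; apply/ffunP => i; rewrite !ffunE IH.
Qed.

Lemma upd_fresh s x t A G : ~~ free x A -> interp (upd s x t) A G <-> interp s A G.
Proof.
by move=> nx; split; apply: interp_ext => z zA; rewrite /upd;
  case: eqVneq => // xz; rewrite xz zA in nx.
Qed.

Lemma eval_upd s y d u : ~~ occurs y u -> eval (upd s y d) u = eval s u.
Proof.
move=> yu; apply: eval_ext => z zu; rewrite /upd.
by case: eqVneq => // yz; rewrite yz zu in yu.
Qed.

Lemma interp_upd_swap s x y t u A G : x != y ->
  interp (upd (upd s x t) y u) A G <-> interp (upd (upd s y u) x t) A G.
Proof.
by move=> xy; split; apply: interp_ext => z _; rewrite /upd;
  case: (eqVneq y z) => // yz; case: (eqVneq x z) => // xz; rewrite xz yz eqxx in xy.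
Qed.

(* The induction step of [interp_subst] under a binder, common to both
   quantifiers. *)
Lemma interp_subst_bound x y u B s d G :
    (free_for u x B -> forall s G,
       interp s (subst x u B) G <-> interp (upd s x (eval s u)) B G) ->
    [|| x == y, ~~ free x B | ~~ occurs y u && free_for u x B] ->
  interp (upd s y d) (if x == y then B else subst x u B) G <->
  interp (upd (upd s x (eval s u)) y d) B G.
Proof.
move=> IB; case: (eqVneq x y) => [-> _|xy] /=.
  by split; apply: interp_ext => z _; rewrite /upd; case: eqP.
case/orP=> [nx|/andP[yu fu]].
  by rewrite subst_id // interp_upd_swap // (upd_fresh _ _ _ nx).
by rewrite IB // eval_upd // interp_upd_swap // eq_sym.
Qed.

Lemma interp_subst x u A : free_for u x A -> forall s G,
  interp s (subst x u A) G <-> interp (upd s x (eval s u)) A G.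
Proof.
elim: A => [a|B IB C IC|B IB C IC|y B IB|y B IB] /=.
- move=> _ s G; case: a => //= p ts.
  suff -> : [ffun i => eval s ([ffun j => subst_term x u (ts j)] i)] =
            [ffun i => eval (upd s x (eval s u)) (ts i)] by [].
  by apply/ffunP => i; rewrite !ffunE eval_subst.
- by move=> /andP[/IB {}IB /IC {}IC] s G; rewrite IB IC.
- move=> /andP[/IB {}IB /IC {}IC] s G.
  by split; (apply: lor_mono => D; [rewrite IB|rewrite IC]).
- move=> fu s G; have H d D := interp_subst_bound s d D IB fu.
  by case: ifP H => _ H; split; apply: lex_mono => d _ D; apply H.
- move=> fu s G; have H d D := interp_subst_bound s d D IB fu.
  by case: ifP H => _ H; split=> i d vd; apply/H; exact: i.
Qed.

Lemma interp_or_elim s A B W G : closed W ->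
    (forall D, List.incl G D -> interp s A D -> W D) ->
    (forall D, List.incl G D -> interp s B D -> W D) ->
  interp s (Or A B) G -> W G.
Proof.
by move=> cW AW BW o; apply: lor_elim cW o AW BW; exact: closed_interp.
Qed.

Lemma interp_ex_elim s x A W G : closed W ->
    (forall t D, value t -> List.incl G D -> interp (upd s x t) A D -> W D) ->
  interp s (Ex x A) G -> W G.
Proof.
by move=> cW AW o; apply: lex_elim cW o AW => t; exact: closed_interp.
Qed.

Lemma interp_incl s A G D : List.incl G D -> interp s A G -> interp s A D.
Proof. exact: closed_incl (@closed_interp _ _). Qed.

(** * Soundness of equivalence *)

Lemma equiv_interp A B : equiv A B -> forall s G, interp s A G <-> interp s B G.
Proof.
have clo := closed_interp.
have orC A' B' s G : interp s (Or A' B') G -> interp s (Or B' A') G.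
  by apply: interp_or_elim => // D _ i; [exact: lor_r|exact: lor_l].
have ren x y (C : formula Sg) s d G : ~~ free y C -> free_for (Var y) x C ->
    interp (upd s y d) (subst x (Var y) C) G <-> interp (upd s x d) C G.
  move=> yC fy; rewrite interp_subst //.
  have -> : eval (upd s y d) (Var y) = d by rewrite /= /upd eqxx.
  split; apply: interp_ext => z zC; rewrite /upd; case: eqVneq => // _;
  by case: eqVneq => // yz; rewrite yz zC in yC.
elim=> {A B}.
- by [].
- by move=> A B _ IH s G; rewrite IH.
- by move=> A B C _ IA _ IB s G; rewrite IA.
- by move=> A A' B B' _ IA _ IB s G /=; rewrite IA IB.
- move=> A A' B B' _ IA _ IB s G /=.
  by split; (apply: lor_mono => D; [rewrite IA|rewrite IB]).
- by move=> x A A' _ IA s G /=; split; apply: lex_mono => d _ D; rewrite IA.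
- by move=> x A A' _ IA s G; split=> i d vd; apply/IA; exact: i.
- by move=> A B s G /=; tauto.
- by move=> A B s G; split; exact: orC.
- by move=> A B C s G /=; tauto.
- move=> A B C s G; split; apply: interp_or_elim => // D _.
  + by move=> i; do 2 apply: lor_l.
  + apply: interp_or_elim => // E _ i; last exact: lor_r.
    by apply: lor_l; apply: lor_r.
  + apply: interp_or_elim => // E _ i; first exact: lor_l.
    by apply: lor_r; apply: lor_l.
  + by move=> i; do 2 apply: lor_r.
- move=> x y A s G; case: (eqVneq x y) => [-> //|xy].
  by have yx := xy; rewrite eq_sym in yx; split=> i d vd e ve; apply/interp_upd_swap => //; exact: i.
- move=> x y A s G; case: (eqVneq x y) => [-> //|xy].
  split; apply: interp_ex_elim => // d D vd _; apply: interp_ex_elim => // e E ve _ i;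
    apply: (lex_intro ve); apply: (lex_intro vd);
    by apply/interp_upd_swap => //; rewrite eq_sym.
- move=> x A B nB s G; split=> [i|].
  (* This direction is classical: for [D] orthogonal to the conclusion, the case [B] is
     contradictory, which leaves [A] at every value [d]. *)
  + apply: closed_contra => // D GD oD; apply: (orth_elim oD); apply: lor_l => d vd.
    have : interp (upd s x d) (Or A B) D by apply: interp_incl GD _; exact: i.
    apply: interp_or_elim => // E DE; move/upd_fresh => /(_ nB) iB.
    apply: closed_contra => // F EF _; apply: (@orth_elim (interp s (Or (All x A) B))).
      by apply: orth_incl oD; solve_incl.
    by apply: lor_r; exact: interp_incl iB.
  + apply: interp_or_elim => // D _ i d vd; first by apply: lor_l; exact: i.
    by apply: lor_r; apply/upd_fresh.
- move=> x A B nB s G; split.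
  + apply: interp_ex_elim => // d D vd _ [iA /upd_fresh iB].
    by split; [exact: lex_intro iA|exact: iB].
  + case=> iA iB; move: iA; apply: interp_ex_elim => // d D vd GD iA.
    apply: (lex_intro vd); split=> //; apply/upd_fresh => //.
    exact: interp_incl iB.
- by move=> x y A yA fy s G; split; apply: lex_mono => d _ D iA; apply/(ren x y A).
- by move=> x y A yA fy s G; split=> i d vd; apply/(ren x y A) => //; exact: i.
Qed.

(** * Duality and excluded middle for atoms *)

Lemma neg_atomK a : neg_atom (neg_atom a) = a.
Proof.
case: a => //= p ts.
(* The double dual is generalised to a symbol [q], so that the equation can be eliminated; arguments
   of different index types are compared by position. *)
have pdK q (e : q = p) (us : {ffun 'I_(parity q) -> term Sg}) :
    (forall i j, val i = val j -> us i = ts j) -> APred us = APred ts.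
  by subst q => us_ts; congr APred; apply/ffunP => i; exact: us_ts.
apply: pdK => [|i j ij]; first exact: pdualK.
by rewrite !ffunE; congr (ts _); exact: val_inj.
Qed.

(** A symbol differs from its dual and [pickle] is injective, so exactly one of the two codes is the
    smaller. *)
Lemma positive_pdual p : positive (pdual p) = ~~ positive p.
Proof.
rewrite /positive pdualK -leqNgt ltn_neqAle.
by case: eqP => // e; case: (pdual_neq (pcan_inj pickleK e)).
Qed.

Lemma eval_neg_atom s a : eval_atom s (neg_atom a) = neg_atom (eval_atom s a).
Proof.
by case: a => //= p ts; congr APred; apply/ffunP => i; rewrite !ffunE.
Qed.

(** Dual predicate atoms denote [orth X] and [orth (orth X)], in an order fixed by polarity. A set
    orthogonal to both lies in [orth (orth X)] and, as [orth X] is closed, in [orth X]; hence it is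
    provable. *)
Lemma interp_atom_em a s G :
  interp s (Or (Atom a) (Atom (neg_atom a))) G.
Proof.
have em X E : lor (orth X) (orth (orth X)) E.
  by move=> D [oo /closed_orth o]; have := orth_elim oo o; apply: provable_incl; solve_incl.
have orC X Y : lor X Y G -> lor Y X G by move=> o D [oX oY]; exact: o.
rewrite /= eval_neg_atom; case: (eval_atom s a) => [||p ts].
- exact: lor_l.
- exact: lor_r.
- have -> : interp_atom (neg_atom (APred ts)) =
      if ~~ positive p then orth (eq [:: Atom (neg_atom (APred ts))])
      else orth (orth (eq [:: Atom (APred ts)])).
    by rewrite -{3}(neg_atomK (APred ts)) -positive_pdual.
  rewrite [interp_atom (APred ts)]/=.
  by case: (positive p) => /=; [|apply: orC]; exact: em.
Qed.

(** * Soundness of derivations *)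

Definition values s := forall x, value (s x).

Lemma values_eval s t : values s -> value (eval s t).
Proof.
move=> vs; elim/term_nested_ind: t => [x|f ts IH] x' /=; first exact: vs.
by case/existsP=> i; rewrite ffunE; exact: IH.
Qed.

Lemma values_upd s x t : values s -> value t -> values (upd s x t).
Proof. by move=> vs vt y; rewrite /upd; case: ifP. Qed.

Lemma inference_interp (k : rule) A B s G : inference k A B -> values s ->
  interp s A G -> interp s B G.
Proof.
have clo := closed_interp.
case=> {k A B}.
- by [].
- by move=> a _ _; exact: interp_atom_em.
- by [].
- move=> A B C _ [iA]; apply: interp_or_elim => // D GD i.
    by apply: lor_l; split=> //; exact: interp_incl iA.
  exact: lor_r.
- by move=> A B _ [iA _]; exact: lor_l.
(* The witness is [eval s u], a value because [s] takes only values. *)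
- move=> x u A fu vs /interp_subst => /(_ fu).
  by apply: lex_intro; exact: values_eval.
- by move=> A B e _; rewrite (equiv_interp e).
- by move=> A B _; exact: lor_l.
- move=> A B C D _; apply: interp_or_elim => // E _ [i1 i2].
    by split; exact: lor_l.
  by split; exact: lor_r.
- by move=> a _; exact: interp_or_elim.
- by move=> x A B _; apply: interp_or_elim => // D _ i d vd; [apply: lor_l|apply: lor_r];
    exact: i.
- move=> x A B _; apply: interp_or_elim => // D _; apply: lex_mono => d _ E.
    exact: lor_l.
  exact: lor_r.
- by move=> x A nA _ i d vd; apply/upd_fresh.
(* Both quantifiers are instantiated with [d]; the inner update overrides the outer one. *)
- move=> x A _ i d vd; apply: interp_ext (i d vd d vd) => z _.
  by rewrite /upd; case: eqP.
- by move=> A _; exact: interp_or_elim.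
Qed.

(** All connectives and quantifiers are monotone, so soundness passes through contexts; the
    assignment varies because a context may bind variables. *)
Lemma derivation_interp R A B s G : derivation R A B -> values s ->
  interp s A G -> interp s B G.
Proof.
move=> d vs; elim: d => // {A B} A B C [k [K [A' [B' [_ i -> ->]]]]] _ IH iA.
apply: IH; elim: K s vs G iA => [|K IH D|D K IH|K IH D|D K IH|x K IH|x K IH] s vs G /=.
- exact: inference_interp i vs.
- by case=> iA iD; split=> //; exact: IH vs _ iA.
- by case=> iD iA; split=> //; exact: IH vs _ iA.
- by apply: lor_mono => // E; exact: IH.
- by apply: lor_mono => // E; exact: IH.
- by apply: lex_mono => t vt E; apply: IH; exact: values_upd.
- by move=> iA t vt; apply: IH (iA t vt); exact: values_upd.
Qed.

End Semantics.

(** * Completeness *)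

Lemma eval_id (Sg : signature) (bound : seq (var Sg)) s (t : term Sg) :
    (forall x, x \notin bound -> s x = Var x) ->
  value bound t -> eval s t = t.
Proof.
move=> s_id; elim/term_nested_ind: t => [x|f ts IH] vt /=.
  by apply/s_id/vt; rewrite /= eqxx.
congr App; apply/ffunP => i; rewrite ffunE; apply: IH => x xi.
by apply: vt; apply/existsP; exists i.
Qed.

(** Induction on size, since the quantifier cases pass to instances; each case ends in the sequent
    rule of its connective. *)
Lemma interp_provable (Sg : signature) (bound : seq (var Sg)) s (A : formula Sg) G :
    (forall x, x \notin bound -> s x = Var x) ->
    {subset bvars A <= bound} -> (forall x, free x A -> x \notin bound) ->
  interp bound s A G -> provable (A :: G).
Proof.
move=> s_id; have [n] := ubnP (fsize A).
have instance x t B : value bound t -> {subset bvars B <= bound} ->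
    (forall z, (z != x) && free z B -> z \notin bound) ->
  [/\ free_for t x B, {subset bvars (subst x t B) <= bound}
    & forall z, free z (subst x t B) -> z \notin bound].
  move=> vt bB fB; split; last by move=> z /free_subst /orP[/fB|/vt].
    by apply: free_for_bvars => y /bB; apply: contraL; exact: vt.
  by rewrite bvars_subst.
elim: n A G => // n IH [a|B C|B C|x B|x B] G /=; rewrite ?ltnS => size_lt bA fA iA.
- have a_id : eval_atom s a = a.
    case: a fA {iA} => //= p ts fA; congr APred; apply/ffunP => i.
    rewrite ffunE; apply: eval_id s_id _ => x xi.
    by apply: fA; apply/existsP; exists i.
  rewrite a_id in iA; case: a iA {fA a_id} => [_||p ts] /=.
  + by apply: provable_true; left.
  + by apply: provable_incl => C CG; right.
  + case: ifP => _; first by move/(_ [:: Atom (APred ts)] erefl).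
    (* The atom alone is orthogonal to its dual by the axiom. *)
    have dual : orth (eq [:: Atom (neg_atom (APred ts))]) [:: Atom (APred ts)].
      by move=> _ <-; apply: (@provable_dual _ _ ts); [right; left|left].
    move/(_ _ dual); apply: provable_incl.
    by move=> C; rewrite In_cat /=; tauto.
- move: iA => [iB iC]; apply: provable_and; apply: IH => //.
  + exact: leq_ltn_trans (leq_addr _ _) size_lt.
  + by move=> y yB; apply: bA; rewrite mem_cat yB.
  + by move=> y yB; apply: fA; rewrite yB.
  + exact: leq_ltn_trans (leq_addl _ _) size_lt.
  + by move=> y yB; apply: bA; rewrite mem_cat yB orbT.
  + by move=> y yB; apply: fA; rewrite yB orbT.
(* A join is an orthogonal, so it suffices that the disjunction alone is orthogonal to both values,
   which the induction hypothesis gives. *)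
- apply: (iA [:: Or B C]); split=> D iD.
    suff: provable (Or B C :: D).
      by apply: provable_incl => E; rewrite In_cat /=; tauto.
    apply: provable_orl; apply: IH => //.
    + exact: leq_ltn_trans (leq_addr _ _) size_lt.
    + by move=> y yB; apply: bA; rewrite mem_cat yB.
    + by move=> y yB; apply: fA; rewrite yB.
  suff: provable (Or B C :: D).
    by apply: provable_incl => E; rewrite In_cat /=; tauto.
  apply: provable_orr; apply: IH => //.
  + exact: leq_ltn_trans (leq_addl _ _) size_lt.
  + by move=> y yB; apply: bA; rewrite mem_cat yB orbT.
  + by move=> y yB; apply: fA; rewrite yB orbT.
- have bB : {subset bvars B <= bound} by move=> y yB; apply: bA; rewrite inE yB orbT.
  apply: (iA [:: Ex x B]) => t vt D iD.
  suff: provable (Ex x B :: D).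
    by apply: provable_incl => E; rewrite In_cat /=; tauto.
  have [ft bt fB] := instance x t B vt bB fA.
  apply: (provable_ex ft); apply: IH => //; first by rewrite fsize_subst.
  by apply/interp_subst => //; rewrite (eval_id s_id vt).
- have bB : {subset bvars B <= bound} by move=> y yB; apply: bA; rewrite inE yB orbT.
  (* Outside [bound], the eigenvariable is itself a value. *)
  have [y yb yG] := exists_fresh (B :: G) bound.
  have vy : value bound (Var y) by move=> z /= /eqP ->.
  have [fy by_ fy_] := instance x _ B vy bB fA.
  apply: (provable_all fy) => [|C CG|]; [by apply: yG; left|by apply: yG; right|].
  apply: IH => //; first by rewrite fsize_subst.
  by apply/interp_subst => //; rewrite (eval_id s_id vy); exact: iA.
Qed.

Theorem theorem6p3 (Sg : signature) (A : formula Sg) :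
  derivation KS1 ftrue A ->
  exists A' : formula Sg,
    [/\ false_free A',
        derivation MLS1X ftrue A'
      & derivation WCE A' A].
Proof.
move=> dA; have [r Hr] := free_vars_finite A.
have [A' [eA bA fA]] := rename_bound r A.
have [y ys] := @var_infinite Sg (bvars A').
(* The identity outside the bound variables; these go to an outside variable [y], so that all
   results are values. *)
pose s (x : var Sg) : term Sg := Var (if x \in bvars A' then y else x).
have vs : values (bvars A') s.
  by move=> x z /= /eqP ->; case: ifP => [_|->].
have iA : interp (bvars A') s A' [::].
  by apply/(equiv_interp _ eA); exact: derivation_interp dA vs I.
have [X [fX dX dXA]] : exists X,
    [/\ false_free X, derivation MLS1X ftrue X & derivation WCE X A'].
  apply/provable_singleton/(interp_provable _ _ _ iA) => // [x|x xA].
    by rewrite /s => /negbTE ->.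
  by apply: contraL (Hr x (fA x xA)) => /bA.
exists X; split=> //; apply: derivation_trans dXA _.
by apply: derivation_equiv => //; exact: equiv_sym.
Qed.
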